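(* Let $a>0$ be a fixed real number, let $\delta>0$, and let $k=k(n)$ be a sequence of positive integers with $k=O\left(n^{\frac1{2+a+\delta}}\right)$. Then for some $\epsilon>0$ we have $$\Pr\left(|Y_n(k)-\mathbb{E}\,Y_n(k)|>\bigl(\mathbb{E}\,Y_n(k)\bigr)^{1-\epsilon}\right)=o(1)\qquad (n\to\infty),$$ where $Y_n(k)$ is the number of vertices of second degree at least $k$ in the Buckley--Osthus random graph $H_{a,1}^n$.
   Context: Buckley--Osthus model ($m=1$). Fix $a>0$. The random multigraph $H_{a,1}^n$ on vertices $1,\dots,n$ is built inductively: $H_{a,1}^1$ consists of one vertex and one loop. Given $H_{a,1}^{t-1}$, the graph $H_{a,1}^{t}$ is obtained by adding one vertex $t$ and one edge between $t$ and a random vertex $i\in\{1,\dots,t\}$, where $$\Pr(i=s)=\frac{d_{H_{a,1}^{t-1}}(s)-1+a}{(a+1)t-1}\ \text{ if } 1\le s\le t-1,\qquad \Pr(i=t)=\frac{a}{(a+1)t-1}.$$ Here $d_H(s)$ is the degree of the vertex $s$ in $H$ (a loop contributes $2$ to the degree). Second degree: for a vertex $t$ of $H_{a,1}^n$, $$d_2(t)=\#\{ij:\ i\neq t,\ j\neq t,\ it\in H_{a,1}^n,\ ij\in H_{a,1}^n\},$$ i.e. the number of edges adjacent to the neighbors of $t$, except for the edges adjacent to $t$. $Y_n(k)$ is the number of vertices $t$ of $H_{a,1}^n$ with $d_2(t)\ge k$. *)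

(* Defs.v *)
From mathcomp Require Import all_boot all_order all_algebra.
From mathcomp Require Import all_classical all_reals all_analysis.

Set Implicit Arguments.
Unset Strict Implicit.
Unset Printing Implicit Defensive.

Import Order.TTheory GRing.Theory Num.Theory.
Import numFieldNormedType.Exports.

Local Open Scope ring_scope.

(* A multigraph is the list of its edges, with multiplicity.  An edge is an
   unordered pair stored in one of its two orders (a loop at [s] is [(s, s)]),
   so the definitions below are symmetric in the two components. *)
Definition multigraph := seq (nat * nat).

Definition degree (G : multigraph) (s : nat) : nat :=
  (\sum_(e <- G) ((e.1 == s) + (e.2 == s)))%N.

Definition adjacent (G : multigraph) (i j : nat) : bool :=
  ((i, j) \in G) || ((j, i) \in G).

(* Every edge is counted once, whichever of its ends is a neighbour of [t]; in
   particular a loop at a neighbour of [t] counts for one. *)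
Definition second_degree (G : multigraph) (t : nat) : nat :=
  count (fun e => [&& e.1 != t, e.2 != t
                    & adjacent G e.1 t || adjacent G e.2 t]) G.

(* [Y n k G], for [G] with vertex set {1, ..., n}. *)
Definition Y (n k : nat) (G : multigraph) : nat :=
  count (fun t => (k <= second_degree G t)%N) (iota 1 n).

Section Model.
Variables (R : realType) (a : R).

(* Probability that the new vertex [t] is joined to [s], where 1 <= s <= t and
   [G] is the graph on {1, ..., t - 1}. *)
Definition attach_prob (G : multigraph) (t s : nat) : R :=
  (if (s < t)%N then (degree G s)%:R - 1 + a else a) / ((a + 1) * t%:R - 1).

(* The law of H_{a,1}^n, as the finite list of the outcomes with their
   probabilities.  The model starts at n = 1; the value at n = 0 is
   conventional. *)
Fixpoint BO_law (n : nat) : seq (multigraph * R) :=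
  match n with
  | 0 => [:: ([::], 1)]
  | 1 => [:: ([:: (1, 1)%N], 1)]
  | n'.+1 => [seq (rcons Gw.1 (s, n), Gw.2 * attach_prob Gw.1 n s)
             | Gw <- BO_law n', s <- iota 1 n]
  end.

Definition Pr (n : nat) (A : pred multigraph) : R :=
  \sum_(Gw <- BO_law n | A Gw.1) Gw.2.

Definition Ex (n : nat) (X : multigraph -> R) : R :=
  \sum_(Gw <- BO_law n) Gw.2 * X Gw.1.

End Model.

(* Main.v *)
Require Import Defs.
From mathcomp Require Import all_boot all_order all_algebra.
From mathcomp Require Import all_classical all_reals all_analysis.
From mathcomp Require Import ring lra zify.

Set Implicit Arguments.
Unset Strict Implicit.
Unset Printing Implicit Defensive.

Import Order.TTheory GRing.Theory Num.Theory.
Import numFieldNormedType.Exports.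

Local Open Scope classical_set_scope.
Local Open Scope ring_scope.

(** Chebyshev's inequality suffices: with N the mean of Y_n(k), it is enough
    that the variance of Y_n(k) is at most k^2 N up to a logarithm, and that N
    is at least of order n / k^a.  Since k = O(n^(1/(2+a+delta))), the latter
    gives k^(2+delta) = O(N), so that k^2 N is smaller than N^2 by a power of
    n, which pays for the logarithm and for the exponent 1 - eps.

    The variance.  As the degree of s minus one is the in-degree of s (a loop
    having one of its ends counted as in-going), the new edge at time t can be
    drawn by choosing with weight a each of the vertices 1, ..., t, or with
    weight 1 each of the t - 1 earlier edges, whose target is then copied; the
    weights add up to (a + 1) t - 1.  So the graph is a function of n
    independent choices (Ex_law), to which the Efron-Stein inequality applies
    (Efron_Stein), in the form where only the drops of Y caused by resampling
    one choice are counted.  Two facts bound the sum of the squared drops.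
    - Each drop is at most 2 k + 3 (Y_reroute).  Resampling one choice moves a
      set of edges, possibly large, from a common target s to a common target
      s'.  However, if many edges point to one vertex, then the vertices they
      come from all have a large second degree, so only about k of them can
      be lost on either side.
    - The drops, over all the choices, add up to at most 2 k L Y, where L is
      the length of the longest chain of copies (wordY_certificates).  Indeed
      d_2(v) >= k is certified by k edges and k edges joining them to v, and
      each of these 2 k edges depends only on the choices along its own chain.
    The sum over the edges of 2^l, with l the length of the chain, has mean
    O(n^2) (lineage_moment), so L is logarithmic (depth_le).

    The mean.  If more than k edges point to s, then at least k of the vertices
    they come from have second degree at least k; hence Y_n(k) is at least k
    times the number of vertices of in-degree greater than k (Y_ge_hubs).  The
    mean number of vertices of in-degree d satisfies a linear recurrence, by
    which it is at least c_d n - 1 (mean_indeg_lower), with c_d of order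
    d^(-2-a) (indeg_density_ge).  Summing over k < d <= 2 k gives the order
    k^2 n k^(-2-a) = n k^(-a), the error terms 1 being negligible exactly
    because n k^(-2-a) tends to infinity. *)

(** * Squared positive parts *)

Section PositivePart.
Variable R : realFieldType.

(** Using the squared positive part instead of the square makes the
    Efron-Stein bound count the decreases of a function only. *)
Definition sqpos (x : R) : R := Num.max x 0 ^+ 2.

Lemma sqposDN x : sqpos x + sqpos (- x) = x ^+ 2.
Proof.
rewrite /sqpos; have [x0|x0] := leP 0 x.
  by rewrite max_r ?oppr_le0 // expr0n addr0.
by rewrite max_l ?oppr_ge0 ?(ltW x0) // expr0n add0r sqrrN.
Qed.

Lemma sqpos_tangent m y : sqpos m + 2 * Num.max m 0 * (y - m) <= sqpos y.
Proof.
rewrite /sqpos; have [m0|m0] := leP m 0.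
  by rewrite mulr0 mul0r addr0 expr0n sqr_ge0.
have [y0|y0] := leP y 0; last by have := sqr_ge0 (y - m); nra.
have : m * y <= 0 by rewrite mulr_ge0_le0 // ltW.
by have := sqr_ge0 m; rewrite expr0n /=; nra.
Qed.

Variables (C : Type) (p : C -> R) (s : seq C).
Hypothesis p_ge0 : forall c, 0 <= p c.
Hypothesis p_sum1 : \sum_(c <- s) p c = 1.

Lemma sqpos_convex (x : C -> R) :
  sqpos (\sum_(c <- s) p c * x c) <= \sum_(c <- s) p c * sqpos (x c).
Proof.
set m := \sum_(c <- s) _.
have -> : sqpos m
    = \sum_(c <- s) p c * (sqpos m + 2 * Num.max m 0 * (x c - m)).
  set M := 2 * _; transitivity
    (\sum_(c <- s) (p c * (sqpos m - M * m) + M * (p c * x c))).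
    rewrite big_split /= -mulr_suml -mulr_sumr p_sum1 -/m; ring.
  by apply: eq_bigr => c _; ring.
by apply: ler_sum => c _; rewrite ler_wpM2l // sqpos_tangent.
Qed.

(** For independent copies X and X', the variance is half the mean of
    (X - X')^2, and by symmetry the positive part carries exactly half. *)
Lemma variance_sqpos (x : C -> R) :
  \sum_(c <- s) p c * x c ^+ 2 - (\sum_(c <- s) p c * x c) ^+ 2
  = \sum_(c <- s) p c * \sum_(d <- s) p d * sqpos (x c - x d).
Proof.
set q := \sum_(c <- s) p c * x c ^+ 2; set m := \sum_(c <- s) p c * x c.
set V := RHS.
have VE : V = \sum_(c <- s) \sum_(d <- s) p c * p d * sqpos (x c - x d).
  by apply: eq_bigr => c _; rewrite mulr_sumr; apply: eq_bigr => d _; ring.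
have VE' : V = \sum_(c <- s) \sum_(d <- s) p c * p d * sqpos (- (x c - x d)).
  rewrite VE exchange_big; apply: eq_bigr => c _; apply: eq_bigr => d _.
  by rewrite opprB [p d * _]mulrC.
suff : V + V = 2 * (q - m ^+ 2) by lra.
rewrite {1}VE VE' -big_split /=.
transitivity (\sum_(c <- s) (p c * x c ^+ 2 + p c * q - 2 * (p c * x c) * m)).
  apply: eq_bigr => c _; rewrite -big_split /=.
  under eq_bigr => d _ do rewrite -mulrDr sqposDN.
  transitivity (\sum_(d <- s) (p c * x c ^+ 2 * p d + p c * (p d * x d ^+ 2)
     - 2 * (p c * x c) * (p d * x d))); first by apply: eq_bigr => d _; ring.
  by rewrite !big_split /= sumrN -!mulr_sumr p_sum1 mulr1.
rewrite !big_split /= sumrN -!mulr_suml -mulr_sumr p_sum1 -/q -/m; ring.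
Qed.

End PositivePart.

(** * Product laws on words and the Efron-Stein inequality *)

Section ProductLaw.
Variables (R : realFieldType) (C : Type).
Variables (ch : nat -> seq C) (p : nat -> C -> R).

(** The mean of [f] over the words of [n] independent letters, the letter at
    position [i] being drawn from [ch i] with weights [p i].  Integrating out
    the last letter first makes every proof below an induction on [n]. *)
Fixpoint wordE (n : nat) (f : seq C -> R) : R :=
  if n is n'.+1
  then wordE n' (fun w => \sum_(c <- ch n') p n' c * f (rcons w c))
  else f [::].

Lemma wordES n f : wordE n.+1 f
  = wordE n (fun w => \sum_(c <- ch n) p n c * f (rcons w c)).
Proof. by []. Qed.

Lemma wordEZ n (x : R) f : wordE n (fun w => x * f w) = x * wordE n f.
Proof.
elim: n f => [//|n IH] f; rewrite !wordES -IH; congr (wordE n _).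
apply: boolp.funext => w.
by rewrite mulr_sumr; apply: eq_bigr => c _; rewrite mulrCA.
Qed.

Lemma wordED n f g : wordE n (fun w => f w + g w) = wordE n f + wordE n g.
Proof.
elim: n f g => [//|n IH] f g; rewrite !wordES -IH; congr (wordE n _).
apply: boolp.funext => w.
by rewrite -big_split; apply: eq_bigr => c _; rewrite mulrDr.
Qed.

Lemma wordEB n f g : wordE n (fun w => f w - g w) = wordE n f - wordE n g.
Proof.
rewrite wordED -[- wordE n g]mulN1r -wordEZ.
by congr (_ + wordE n _); apply: boolp.funext => w; rewrite mulN1r.
Qed.

Lemma wordE_sum n I (r : seq I) f :
  wordE n (fun w => \sum_(i <- r) f i w) = \sum_(i <- r) wordE n (f i).
Proof.
elim: r => [|i r IH].
  rewrite big_nil -[RHS](mul0r (wordE n (fun=> 0))) -wordEZ.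
  by congr (wordE n _); apply: boolp.funext => w; rewrite big_nil mul0r.
rewrite big_cons -IH -wordED.
by congr (wordE n _); apply: boolp.funext => w; rewrite big_cons.
Qed.

Hypothesis p_sum1 : forall n, \sum_(c <- ch n) p n c = 1.

Lemma wordE_cst n x : wordE n (fun=> x) = x.
Proof.
elim: n => [//|n IH]; rewrite wordES -[RHS]IH; congr (wordE n _).
by apply: boolp.funext => w; rewrite -mulr_suml p_sum1 mul1r.
Qed.

End ProductLaw.

Section SetNth.
Variables (C : Type) (c0 : C).

Lemma set_nth_rcons_last w c d :
  set_nth c0 (rcons w c) (size w) d = rcons w d.
Proof. by elim: w => [|x w IH] //=; rewrite IH. Qed.

Lemma set_nth_rcons w c i d : (i < size w)%N ->
  set_nth c0 (rcons w c) i d = rcons (set_nth c0 w i d) c.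
Proof. by elim: w i => [|x w IH] [|i] //= /IH ->. Qed.

End SetNth.

Section ProductLawEq.
Variables (R : realFieldType) (C : eqType).
Variables (ch : nat -> seq C) (p : nat -> C -> R) (c0 : C).
Hypothesis p_ge0 : forall n c, 0 <= p n c.
Hypothesis p_sum1 : forall n, \sum_(c <- ch n) p n c = 1.

Local Notation wordE := (wordE ch p).

(** The product law is carried by these words, so that estimates of means need
    only be proved for them. *)
Definition word_of (n : nat) (w : seq C) :=
  size w = n /\ forall i, (i < n)%N -> nth c0 w i \in ch i.

Lemma word_of_rcons n w c : word_of n w -> c \in ch n -> word_of n.+1 (rcons w c).
Proof.
move=> [sw wP] cP; split=> [|i]; first by rewrite size_rcons sw.
rewrite ltnS leq_eqVlt nth_rcons sw => /orP[/eqP->|ilt].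
  by rewrite ltnn eqxx.
by rewrite ilt wP.
Qed.

Lemma ler_wordE n f g :
  (forall w, word_of n w -> f w <= g w) -> wordE n f <= wordE n g.
Proof.
elim: n f g => [|n IH] f g fg; first by apply: fg; split.
rewrite !wordES; apply: IH => w wP.
rewrite big_seq [leRHS]big_seq; apply: ler_sum => c cP.
by rewrite ler_wpM2l // fg //; apply: word_of_rcons.
Qed.

Lemma eq_wordE n f g :
  (forall w, word_of n w -> f w = g w) -> wordE n f = wordE n g.
Proof. by move=> fg; apply/le_anti/andP; split; apply: ler_wordE => w /fg->. Qed.

(** Induction on the number of letters.  The variance splits into the mean of
    the conditional variance given all letters but the last, which is the last
    term, and the variance of the conditional mean [g]; the induction hypothesis
    bounds the latter by the terms of [g], and these are at most the terms of
    [f] because the squared positive part is convex. *)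
Lemma Efron_Stein n f :
  wordE n (fun w => f w ^+ 2) - wordE n f ^+ 2
  <= \sum_(i < n) wordE n (fun w =>
       \sum_(c <- ch i) p i c * sqpos (f w - f (set_nth c0 w i c))).
Proof.
elim: n f => [|n IH] f; first by rewrite big_ord0 subrr.
pose g w := \sum_(c <- ch n) p n c * f (rcons w c).
have -> : wordE n.+1 (fun w => f w ^+ 2) - wordE n.+1 f ^+ 2
  = wordE n (fun w => g w ^+ 2) - wordE n g ^+ 2
    + wordE n (fun w => \sum_(c <- ch n) p n c * f (rcons w c) ^+ 2 - g w ^+ 2).
  rewrite !wordES wordEB -/g; lra.
rewrite big_ord_recr /=; apply: lerD; last first.
  apply: ler_wordE => w [sw _]; rewrite variance_sqpos //.
  rewrite le_eqVlt; apply/orP; left; apply/eqP.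
  apply: eq_bigr => c _; congr (_ * _); apply: eq_bigr => d _; congr (_ * sqpos (_ - f _)).
  by rewrite -sw set_nth_rcons_last.
apply: (le_trans (IH g)); apply: ler_sum => i _.
apply: ler_wordE => w [sw _].
have -> : \sum_(c <- ch n) p n c * \sum_(d <- ch i) p i d *
            sqpos (f (rcons w c) - f (set_nth c0 (rcons w c) i d))
  = \sum_(d <- ch i) p i d * \sum_(c <- ch n) p n c *
            sqpos (f (rcons w c) - f (set_nth c0 (rcons w c) i d)).
  under eq_bigr => c _ do rewrite mulr_sumr.
  rewrite exchange_big /=; apply: eq_bigr => d _; rewrite mulr_sumr.
  by apply: eq_bigr => c _; rewrite mulrCA.
apply: ler_sum => d _; rewrite ler_wpM2l //.
have -> : g w - g (set_nth c0 w i d)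
  = \sum_(c <- ch n) p n c * (f (rcons w c) - f (rcons (set_nth c0 w i d) c)).
  by rewrite -sumrB; apply: eq_bigr => c _; rewrite mulrBr.
apply: le_trans (sqpos_convex _ _ _) _ => //.
rewrite le_eqVlt; apply/orP; left; apply/eqP.
apply: eq_bigr => c _; congr (_ * sqpos (_ - f _)).
by rewrite set_nth_rcons // sw.
Qed.

End ProductLawEq.

(** * Second degrees when one edge is attached to each vertex *)

Section ParentList.
Local Open Scope nat_scope.
Implicit Types (tg : seq nat) (n k v s : nat).

(** Vertices are numbered from 1, the entries of [tg] from 0. *)
Definition tree_graph tg : multigraph :=
  mkseq (fun i => (nth 0 tg i, i.+1)) (size tg).

Lemma tree_graph_rcons tg s :
  tree_graph (rcons tg s) = rcons (tree_graph tg) (s, (size tg).+1).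
Proof.
rewrite /tree_graph /mkseq size_rcons -[in LHS]addn1 iotaD map_cat cats1 /=.
rewrite add0n nth_rcons ltnn eqxx; congr rcons.
by apply/eq_in_map => i; rewrite mem_iota /= add0n nth_rcons => ->.
Qed.

Definition joins tg (i x y : nat) : bool :=
  (nth 0 tg i == x) && (i.+1 == y) || (nth 0 tg i == y) && (i.+1 == x).

Lemma adjacentP tg x y :
  reflect (exists2 i, i < size tg & joins tg i x y)
          (Defs.adjacent (tree_graph tg) x y).
Proof.
apply: (iffP orP) => [[]/mapP[i]|[i ilt /orP[]/andP[/eqP<- /eqP<-]]].
- by rewrite mem_iota => ilt [-> ->]; exists i; rewrite // /joins !eqxx.
- by rewrite mem_iota => ilt [-> ->]; exists i; rewrite // /joins !eqxx orbT.
- by left; apply/mapP; exists i; rewrite // mem_iota.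
- by right; apply/mapP; exists i; rewrite // mem_iota.
Qed.

Definition second_edge tg v i : bool :=
  [&& nth 0 tg i != v, i.+1 != v &
      Defs.adjacent (tree_graph tg) (nth 0 tg i) v
      || Defs.adjacent (tree_graph tg) i.+1 v].

Lemma second_degreeE tg v :
  second_degree (tree_graph tg) v = count (second_edge tg v) (iota 0 (size tg)).
Proof. by rewrite /second_degree count_map. Qed.

Lemma YE n k G : Y n k G = count (fun i => k <= second_degree G i.+1) (iota 0 n).
Proof. by rewrite /Y (iotaDl 1 0 n) count_map. Qed.

Lemma count_eq_iota x m n : count (fun i => i == x) (iota m n) <= 1.
Proof. by rewrite (count_uniq_mem x (iota_uniq m n)) leq_b1. Qed.

Lemma count_neq_iota (P : pred nat) x m n :
  count P (iota m n) <= (count (fun i => P i && (i != x)) (iota m n)).+1.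
Proof.
rewrite -addn1; apply: leq_trans (leq_add (leqnn _) (count_eq_iota x m n)).
rewrite -count_predUI; apply: leq_trans (leq_addr _ _).
by apply: sub_count => i /= ->; case: (i == x).
Qed.

Lemma sub_count_in (P Q : pred nat) (r : seq nat) :
  {in r, forall i, P i -> Q i} -> count P r <= count Q r.
Proof.
move=> PQ; rewrite -(@eq_in_count _ (fun i => P i && Q i)).
  by apply: sub_count => i /andP[].
by move=> i /PQ; case: (P i) => // ->.
Qed.

Lemma count_nth (tg : seq nat) s :
  count_mem s tg = count (fun i => nth 0 tg i == s) (iota 0 (size tg)).
Proof. by rewrite -{1}(mkseq_nth 0 tg) count_map. Qed.

(** Apart from the edge of [v], the edges that point to the parent [s] of [v]
    are all counted in the second degree of [v]. *)
Lemma second_degree_ge_sibling tg s v : v <= size tg -> 0 < v -> v != s ->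
  nth 0 tg v.-1 = s -> count_mem s tg <= (second_degree (tree_graph tg) v).+1.
Proof.
move=> vn v0 vs tgv; rewrite second_degreeE count_nth.
apply: leq_trans (count_neq_iota _ v.-1 _ _) _; rewrite ltnS.
apply: sub_count_in => i; rewrite mem_iota add0n => /= ilt /andP[/eqP iE iv].
rewrite /second_edge iE eq_sym vs /=; apply/andP; split.
  by apply: contraNneq iv => <-.
apply/orP; left; apply/adjacentP; exists v.-1; first by rewrite prednK.
by rewrite /joins tgv prednK // !eqxx.
Qed.

Section Reroute.
Variables (tg tg' : seq nat) (n s s' : nat).
Hypotheses (sz : size tg = n) (sz' : size tg' = n).
Hypothesis moved : forall i, i < n -> nth 0 tg i != nth 0 tg' i ->
  nth 0 tg i = s /\ nth 0 tg' i = s'.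

Let D i := nth 0 tg i != nth 0 tg' i.

(** A vertex that is not adjacent to [s] keeps its neighbours, and the moved
    edges that it sees, it sees through their fixed end. *)
Lemma second_degree_reroute v : v.+1 != s -> v.+1 != s' -> v.+1 != nth 0 tg s.-1 ->
  v < n -> nth 0 tg v != s -> ~~ D v ->
  second_degree (tree_graph tg) v.+1 <= second_degree (tree_graph tg') v.+1.
Proof.
move=> vs vs' vp vn tgv Dv.
have adjW x : Defs.adjacent (tree_graph tg) x v.+1 ->
    Defs.adjacent (tree_graph tg') x v.+1.
  move=> /adjacentP[i]; rewrite sz => ilt ij.
  apply/adjacentP; exists i; first by rewrite sz'.
  move: ij; rewrite /joins; have [<-//|Di] := eqVneq (nth 0 tg i) (nth 0 tg' i).
  have [-> _] := moved ilt Di; rewrite [s == v.+1]eq_sym (negbTE vs) orbF.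
  by move=> /andP[_ /eqP[iv]]; rewrite /D -iv Di in Dv.
have adjs : ~~ Defs.adjacent (tree_graph tg) s v.+1.
  apply/adjacentP => -[i _ /orP[]/andP[/eqP iE /eqP]].
    by move=> [iv]; rewrite -iv iE eqxx in tgv.
  by move=> iS; rewrite -iS /= iE eqxx in vp.
rewrite !second_degreeE sz sz'; apply: sub_count_in => i.
rewrite mem_iota add0n => /= ilt; rewrite /second_edge.
have [<- /and3P[-> -> /orP[]/adjW->//]|Di] := eqVneq (nth 0 tg i) (nth 0 tg' i).
  by rewrite orbT.
have [-> ->] := moved ilt Di.
rewrite (negbTE adjs) /= => /and3P[_ -> /adjW ->].
by rewrite orbT [s' == _]eq_sym vs'.
Qed.

(** A vertex lost by the rerouting is [s], [s'] or the parent of [s], or has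
    moved, or is still attached to [s].  All moved vertices end up attached to
    [s'], so if more than [k] of them moved then none is lost; likewise, if
    more than [k] vertices remain attached to [s] then none of those is lost.
    So each of the last two kinds loses at most [k] vertices. *)
Lemma Y_reroute k :
  Y n k (tree_graph tg) <= Y n k (tree_graph tg') + (2 * k + 3).
Proof.
pose cD := count D (iota 0 n); pose cs := count_mem s tg'.
pose P i := k <= second_degree (tree_graph tg) i.+1.
pose P' i := k <= second_degree (tree_graph tg') i.+1.
pose A i := D i && (cD <= k); pose B i := (nth 0 tg' i == s) && (cs <= k).
have csE : cs = count (fun i => nth 0 tg' i == s) (iota 0 n).
  by rewrite /cs count_nth sz'.
have cA : count A (iota 0 n) <= k.
  have [lk|lk] := leqP cD k; last first.
    by rewrite (eq_count (a2 := pred0)) ?count_pred0 // => i; rewrite /A leqNgt lk andbF.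
  by apply: leq_trans lk; apply: sub_count => i /andP[].
have cB : count B (iota 0 n) <= k.
  have [lk|lk] := leqP cs k; last first.
    by rewrite (eq_count (a2 := pred0)) ?count_pred0 // => i; rewrite /B leqNgt lk andbF.
  by apply: leq_trans lk; rewrite csE; apply: sub_count => i /andP[].
have lost i : i \in iota 0 n -> P i ->
    [|| P' i, i == s.-1, i == s'.-1, i == (nth 0 tg s.-1).-1, A i | B i].
  rewrite mem_iota add0n => /= ilt Pi.
  have [//|nP'] := boolP (P' i); rewrite /P' -ltnNge in nP'.
  have [//|is_] := eqVneq i s.-1; have [//|is'] := eqVneq i s'.-1.
  have [//|ip] := eqVneq i (nth 0 tg s.-1).-1 => /=.
  have neq x : i != x.-1 -> i.+1 != x by apply: contraNneq => <-.
  have bound x : i.+1 != x -> nth 0 tg' i = x -> count_mem x tg' <= k.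
    move=> xi tgi; apply: leq_trans nP'.
    by apply: second_degree_ge_sibling; rewrite ?sz'.
  have [Di|Di] := boolP (D i).
    have [_ tgi] := moved ilt Di; rewrite /A Di /=; apply/orP; left.
    apply: leq_trans (bound _ (neq _ is') tgi).
    rewrite count_nth sz'; apply: sub_count_in => j.
    by rewrite mem_iota add0n => /= jlt Dj /=; have [_ ->] := moved jlt Dj.
  have [tgi|tgi] := eqVneq (nth 0 tg' i) s.
    by rewrite /B tgi eqxx (bound _ (neq _ is_) tgi) orbT.
  have tgi' : nth 0 tg i != s by move: Di; rewrite /D negbK => /eqP->.
  have := second_degree_reroute (neq _ is_) (neq _ is') (neq _ ip) ilt tgi' Di.
  by move=> le2; move: nP'; rewrite ltnNge (leq_trans Pi).
rewrite !YE -/P -/P'; apply: leq_trans (sub_count_in lost) _.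
pose cnt Q := count Q (iota 0 n).
have cU Q1 Q2 : cnt (fun i => Q1 i || Q2 i) <= cnt Q1 + cnt Q2.
  by rewrite /cnt -count_predUI leq_addr.
apply: leq_trans (cU P' (fun i => [|| i == s.-1, i == s'.-1, i == (nth 0 tg s.-1).-1, A i | B i])) _.
rewrite leq_add2l.
have c1 x (Q : pred nat) m : cnt Q <= m -> cnt (fun i => (i == x) || Q i) <= m.+1.
  by move=> Qm; apply: leq_trans (cU _ _) _; rewrite -add1n leq_add ?count_eq_iota.
rewrite addn3; do 3 apply: (c1); apply: leq_trans (cU _ _) _.
by rewrite mul2n -addnn leq_add.
Qed.

End Reroute.

(** [E] consists of [k] edges counted in the second degree of [v] and, for each
    of them, of one edge that joins it to [v]. *)
Lemma second_degree_certificate tg v k :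
  k <= second_degree (tree_graph tg) v ->
  exists E : seq nat, [/\ size E <= 2 * k, {in E, forall i, i < size tg} &
    forall tg', size tg' = size tg ->
      {in E, forall i, nth 0 tg' i = nth 0 tg i} ->
      k <= second_degree (tree_graph tg') v].
Proof.
set n := size tg; rewrite second_degreeE -/n => kle.
pose l := take k (seq.filter (second_edge tg v) (iota 0 n)).
have sl : size l = k by rewrite size_takel // size_filter.
have lP i : i \in l -> i < n /\ second_edge tg v i.
  move=> /mem_take; rewrite mem_filter mem_iota add0n => /andP[-> /= ->].
  by split.
pose w i := find (fun j => joins tg j (nth 0 tg i) v || joins tg j i.+1 v) (iota 0 n).
have wP i : i \in l ->
    w i < n /\ (joins tg (w i) (nth 0 tg i) v || joins tg (w i) i.+1 v).
  move=> /lP[_ /and3P[_ _ adj]].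
  have hasj : has (fun j => joins tg j (nth 0 tg i) v || joins tg j i.+1 v) (iota 0 n).
    apply/hasP; case/orP: adj => /adjacentP[j jlt ji]; exists j;
      by rewrite ?mem_iota ?ji ?orbT.
  have wn : w i < n by move: hasj; rewrite has_find size_iota.
  by split=> //; have := nth_find 0 hasj; rewrite nth_iota.
exists (l ++ map w l); split.
- by rewrite size_cat size_map sl mul2n addnn.
- by move=> i; rewrite mem_cat => /orP[/lP[]//|/mapP[j /wP[jn _] ->]].
move=> tg' sz agree; rewrite second_degreeE sz.
have l_uniq : uniq l by rewrite take_uniq // filter_uniq // iota_uniq.
rewrite -{1}sl -size_filter; apply: uniq_leq_size => // i il.
have [iln /and3P[i1 i2 _]] := lP _ il.
have iE : nth 0 tg' i = nth 0 tg i by apply: agree; rewrite mem_cat il.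
have wE : nth 0 tg' (w i) = nth 0 tg (w i).
  by apply: agree; rewrite mem_cat map_f // orbT.
rewrite mem_filter mem_iota add0n iln andbT /second_edge iE i1 i2 /=.
have [wn wj] := wP _ il; rewrite leq0n andbT.
apply/orP; case/orP: wj => wj; [left|right];
  by apply/adjacentP; exists (w i); rewrite ?sz // /joins wE.
Qed.

End ParentList.

(** * Sequences computed from their own history *)

Section History.
Variables (C T : Type) (step : seq T -> C -> T) (c0 : C) (x0 : T).

Definition history (w : seq C) : seq T :=
  foldl (fun h c => rcons h (step h c)) [::] w.

Lemma history_rcons w c :
  history (rcons w c) = rcons (history w) (step (history w) c).
Proof. by rewrite /history foldl_rcons. Qed.

Lemma size_history w : size (history w) = size w.
Proof.
by elim/last_ind: w => [//|w c IH]; rewrite history_rcons !size_rcons IH.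
Qed.

Lemma nth_history w i : (i < size w)%N ->
  nth x0 (history w) i = step (take i (history w)) (nth c0 w i).
Proof.
elim/last_ind: w => [//|w c IH].
rewrite size_rcons ltnS leq_eqVlt history_rcons => /predU1P[->|ilt].
  rewrite !nth_rcons size_history ltnn eqxx -cats1 take_cat size_history ltnn.
  by rewrite subnn cats0.
rewrite !nth_rcons size_history ilt IH // -cats1 take_cat size_history.
by rewrite ilt.
Qed.

End History.

(** * Targets determined by copying choices *)

Section CopyModel.
Local Open Scope nat_scope.

(** [(true, s)] attaches the new vertex to the vertex [s]; [(false, j)] attaches
    it where the edge of index [j] points. *)
Definition copy_choice := (bool * nat)%type.
Definition dflt_choice : copy_choice := (true, 0).
Local Notation c0 := dflt_choice.

Definition pick_target (tg : seq nat) (c : copy_choice) : nat :=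
  if c.1 then c.2 else nth 0 tg c.2.

Definition targets : seq copy_choice -> seq nat := history pick_target.

(** The lineage of an edge lists the indices of the choices that its target
    depends on: its own and, when it copies, those of the edge it copies. *)
Definition lineages : seq copy_choice -> seq (seq nat) :=
  history (fun h c => size h :: if c.1 then [::] else nth [::] h c.2).

Definition lineage w i := nth [::] (lineages w) i.

Lemma nth_targets w i : i < size w ->
  nth 0 (targets w) i = let c := nth c0 w i in
    if c.1 then c.2 else if c.2 < i then nth 0 (targets w) c.2 else 0.
Proof.
move=> ilt; rewrite /targets (nth_history _ c0) //= /pick_target.
case: ifP => // _; case: ifP => [jlt|/negbT]; first by rewrite nth_take.
by rewrite -leqNgt => jge; rewrite nth_default // size_take size_history ilt.
Qed.

Lemma lineageE w i : i < size w ->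
  lineage w i = i :: let c := nth c0 w i in
    if ~~ c.1 && (c.2 < i) then lineage w c.2 else [::].
Proof.
move=> ilt; rewrite /lineage /lineages (nth_history _ c0) //=.
rewrite size_takel ?size_history ?(ltnW ilt) //; congr (_ :: _).
case: ifP => //= _; case: ifP => [jlt|/negbT]; first by rewrite nth_take.
by rewrite -leqNgt => jge; rewrite nth_default // size_take size_history ilt.
Qed.

Section ChangeOneChoice.
Variables (w : seq copy_choice) (t : nat) (c : copy_choice).
Hypothesis tlt : t < size w.
Let w' := set_nth c0 w t c.

Let size_w' : size w' = size w.
Proof. by rewrite size_set_nth; apply/maxn_idPr. Qed.

Lemma target_off_lineage i : i < size w -> t \notin lineage w i ->
  nth 0 (targets w') i = nth 0 (targets w) i.
Proof.
elim/ltn_ind: i => i IH ilt; rewrite lineageE // inE negb_or => /andP[ti tnl].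
rewrite !nth_targets ?size_w' // nth_set_nth /= eq_sym (negbTE ti).
case: ifP => // c1; case: ifP => // clt; rewrite IH ?(ltn_trans clt ilt) //.
by move: tnl; rewrite /= c1 clt.
Qed.

(** An edge changes its target only if it is the edge of index [t] or copies it,
    directly or not; so before and after the change it points where the edge of
    index [t] does. *)
Lemma targets_moved i : i < size w ->
  nth 0 (targets w) i != nth 0 (targets w') i ->
  nth 0 (targets w) i = nth 0 (targets w) t
  /\ nth 0 (targets w') i = nth 0 (targets w') t.
Proof.
elim/ltn_ind: i => i IH ilt; have [-> //|it] := eqVneq i t.
rewrite [nth 0 (targets w) i]nth_targets // [nth 0 (targets w') i]nth_targets ?size_w' //.
rewrite nth_set_nth /= (negbTE it).
case: ifP => [_|c1]; first by rewrite eqxx.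
case: ifP => [clt|_]; last by rewrite eqxx.
by apply: IH => //; apply: ltn_trans ilt.
Qed.

End ChangeOneChoice.

(** The choice of index [n] attaches the vertex [n.+1]. *)
Definition choices (n : nat) : seq copy_choice :=
  [seq (true, s) | s <- iota 1 n.+1] ++ [seq (false, j) | j <- iota 0 n].

Lemma mem_choices n c : c \in choices n ->
  if c.1 then 0 < c.2 <= n.+1 else c.2 < n.
Proof.
rewrite mem_cat => /orP[]/mapP[x]; rewrite mem_iota => xP -> //=.
Qed.

Lemma targets_range n w : word_of choices c0 n w ->
  forall i, i < n -> 0 < nth 0 (targets w) i <= i.+1.
Proof.
move=> [sw wP]; elim/ltn_ind => i IH ilt; rewrite nth_targets ?sw //=.
have := mem_choices (wP i ilt); case: ifP => // _ clt; rewrite clt.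
have /andP[-> /leq_trans->//] := IH _ clt (ltn_trans clt ilt).
by rewrite ltnW // ltnS.
Qed.

End CopyModel.
Local Notation c0 := dflt_choice.

(** * The copying law and the attachment law *)

Section CopyLaw.
Variables (R : realType) (a : R).
Hypothesis a_gt0 : 0 < a.

Definition total_weight (n : nat) : R := (a + 1) * n.+1%:R - 1.

Lemma total_weightE n : total_weight n = a * n.+1%:R + n%:R.
Proof. by rewrite /total_weight -natr1; ring. Qed.

Lemma total_weight_gt0 n : 0 < total_weight n.
Proof. by rewrite total_weightE ltr_wpDr ?ler0n // mulr_gt0 ?ltr0n. Qed.

Definition choice_prob (n : nat) (c : copy_choice) : R :=
  (if c.1 then a else 1) / total_weight n.

Lemma choice_prob_ge0 n c : 0 <= choice_prob n c.
Proof.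
by apply: divr_ge0; [case: ifP => _ //; exact: ltW | exact/ltW/total_weight_gt0].
Qed.

Lemma sum_choices n (F : copy_choice -> R) :
  \sum_(c <- choices n) choice_prob n c * F c
  = (a * \sum_(s <- iota 1 n.+1) F (true, s) + \sum_(j <- iota 0 n) F (false, j))
    / total_weight n.
Proof.
rewrite big_cat !big_map /= mulrDl; congr (_ + _).
  by rewrite [RHS]mulrAC mulr_sumr; apply: eq_bigr => i _.
by rewrite mulr_suml; apply: eq_bigr => i _; rewrite /choice_prob div1r mulrC.
Qed.

Lemma choice_prob_sum1 n : \sum_(c <- choices n) choice_prob n c = 1.
Proof.
under eq_bigr => c _ do rewrite -[choice_prob n c]mulr1.
rewrite sum_choices !big_const_seq !count_predT !size_iota !iter_addr_0.
by rewrite -total_weightE divff // gt_eqF // total_weight_gt0.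
Qed.

Definition wordEx : nat -> (seq copy_choice -> R) -> R := wordE choices choice_prob.

Lemma sum_count_mem (tg : seq nat) (r : seq nat) (H : nat -> R) :
  uniq r -> {subset tg <= r} ->
  \sum_(s <- tg) H s = \sum_(s <- r) (count_mem s tg)%:R * H s.
Proof.
move=> ur; elim: tg => [|x tg IH] sub.
  by rewrite big_nil big1 // => s _; rewrite mul0r.
rewrite big_cons IH; last by move=> y yt; apply: sub; rewrite inE yt orbT.
have xr : x \in r by apply: sub; rewrite mem_head.
rewrite (bigD1_seq x) //= [RHS](bigD1_seq x) //= eqxx add1n -natr1 addrA.
congr (_ + _); first by ring.
by apply: eq_bigr => s sx; rewrite eq_sym (negbTE sx).
Qed.

Lemma targets_subset n w : word_of choices c0 n w ->
  {subset targets w <= iota 1 n}.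
Proof.
move=> wP s /(nthP 0%N)[i]; rewrite size_history wP.1 => ilt <-.
rewrite mem_iota add1n ltnS; have /andP[-> le] := targets_range wP ilt.
by rewrite (leq_trans le).
Qed.

(** A vertex is chosen directly with weight [a], and through each of the edges
    that point to it with weight 1. *)
Lemma attach_step n w (H : nat -> R) : word_of choices c0 n w ->
  \sum_(c <- choices n) choice_prob n c * H (pick_target (targets w) c)
  = (\sum_(s <- iota 1 n) ((count_mem s (targets w))%:R + a) * H s + a * H n.+1)
    / total_weight n.
Proof.
move=> wP; rewrite sum_choices; congr (_ / _).
rewrite -(addn1 n) iotaD big_cat /= big_seq1 add1n addn1.
under [in RHS]eq_bigr => s _ do rewrite mulrDl.
rewrite big_split /= -sum_count_mem ?iota_uniq //; last exact: targets_subset.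
rewrite -mulr_sumr -[targets w in RHS](mkseq_nth 0%N) big_map.
by rewrite size_history wP.1 /pick_target /=; ring.
Qed.

Lemma degree_tree_graph (tg : seq nat) s :
  degree (tree_graph tg) s = (count_mem s tg + (0 < s <= size tg))%N.
Proof.
rewrite /degree big_map big_split /=; congr (_ + _)%N.
  rewrite -[tg in RHS](mkseq_nth 0%N) count_map -sum1_count [RHS]big_mkcond /=.
  by apply: eq_bigr => i _; case: eqP.
case: s => [|s] /=.
  by rewrite big1.
transitivity (count (fun i => i == s) (iota 0 (size tg))).
  by rewrite -sum1_count [RHS]big_mkcond /=; apply: eq_bigr => i _; rewrite eqSS; case: eqP.
by rewrite (count_uniq_mem s (iota_uniq _ _)) mem_iota.
Qed.

(** In a graph of the model the degree minus one is the in-degree, so by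
    [attach_step] both laws attach the new vertex with the same probabilities. *)
Lemma Ex_law n (F : multigraph -> R) :
  Ex a n F = wordEx n (fun w => F (tree_graph (targets w))).
Proof.
have step m (X : multigraph -> R) : wordEx m.+1 (fun w => X (tree_graph (targets w)))
  = wordEx m (fun w => \sum_(s <- iota 1 m.+1)
      attach_prob a (tree_graph (targets w)) m.+1 s
      * X (rcons (tree_graph (targets w)) (s, m.+1))).
  rewrite /wordEx wordES; apply: (@eq_wordE _ _ _ _ c0); first exact: choice_prob_ge0.
  move=> w wP; have sw : size (targets w) = m by rewrite size_history wP.1.
  under eq_bigr => c _ do rewrite /targets history_rcons tree_graph_rcons -/targets sw.
  rewrite (attach_step (fun s => X (rcons (tree_graph (targets w)) (s, m.+1)))) //.
  rewrite -(addn1 m) iotaD big_cat big_seq1 /= add1n mulrDl mulr_suml.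
  rewrite /attach_prob !addn1 ltnn; congr (_ + _); last by rewrite mulrAC.
  rewrite big_seq [RHS]big_seq; apply: eq_bigr => s.
  rewrite mem_iota add1n => /andP[s0 slt]; rewrite slt degree_tree_graph sw s0 -ltnS slt.
  by rewrite natrD addrK mulrAC.
elim: n F => [|n IH] F.
  by rewrite /Ex /= big_seq1 mul1r.
rewrite step; case: n IH => [_|n IH].
  rewrite /Ex /wordEx /= !big_seq1 /attach_prob /=.
  by rewrite mulr1 addrK divff ?gt_eqF.
rewrite -(IH (fun G => \sum_(s <- iota 1 n.+2)
  attach_prob a G n.+2 s * F (rcons G (s, n.+2)))) /Ex.
have -> : BO_law a n.+2
  = [seq (rcons Gw.1 (s, n.+2), Gw.2 * attach_prob a Gw.1 n.+2 s)
    | Gw <- BO_law a n.+1, s <- iota 1 n.+2] by [].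
rewrite big_allpairs_dep; apply: eq_bigr => Gx _; rewrite mulr_sumr.
by apply: eq_bigr => s _; rewrite [RHS]mulrA.
Qed.

(** Given the past, the new term has mean at most 2 plus 2 / n times the
    current sum: copying a uniform earlier edge lengthens its lineage by one.
    So the means S n satisfy S (n + 1) <= (1 + 2 / n) S n + 2, and 2 n^2
    satisfies this with equality. *)
Lemma lineage_moment n :
  wordEx n (fun w => \sum_(l <- lineages w) 2 ^+ size l) <= 2 * n%:R ^+ 2.
Proof.
elim: n => [|n IH].
  by rewrite /wordEx /= big_nil expr0n mulr0.
rewrite /wordEx wordES -/wordEx.
apply: (@le_trans _ _ (wordEx n (fun w =>
   (1 + 2 / total_weight n) * (\sum_(l <- lineages w) 2 ^+ size l)
   + 2 * (a * n.+1%:R / total_weight n)))).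
  apply: (@ler_wordE _ _ _ _ c0); first exact: choice_prob_ge0.
  move=> w [sw _]; set S := \sum_(l <- lineages w) _.
  have sl : size (lineages w) = n by rewrite size_history.
  under eq_bigr => c _ do rewrite /lineages history_rcons -/lineages -cats1 big_cat /=
     big_seq1 -/S mulrDr.
  rewrite big_split /= -mulr_suml choice_prob_sum1 sum_choices.
  rewrite [\sum_(s <- iota 1 _) _](eq_bigr (fun=> 2)) => [|s _]; last by rewrite /= expr1.
  rewrite big_const_seq count_predT size_iota iter_addr_0 /=.
  under eq_bigr => j _ do rewrite exprS.
  rewrite -mulr_sumr.
  have -> : \sum_(j <- iota 0 n) 2 ^+ size (nth [::] (lineages w) j) = S :> R.
    by rewrite /S -{2}(mkseq_nth [::] (lineages w)) big_map sl.
  rewrite le_eqVlt; apply/orP; left; apply/eqP.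
  by rewrite -[_ *+ n.+1]mulr_natr; field; rewrite gt_eqF // total_weight_gt0.
rewrite /wordEx wordED wordEZ wordE_cst ?choice_prob_sum1 //; last first.
  exact: choice_prob_sum1.
have Z0 := total_weight_gt0 n; have ZE := total_weightE n.
(* The bound 2 / n on the growth rate needs 0 < n. *)
case: n IH Z0 ZE => [|n] IH Z0 ZE.
  rewrite -/wordEx in IH *.
  have -> : wordEx 0 (fun w => \sum_(l <- lineages w) 2 ^+ size l) = 0.
    by rewrite /wordEx /= big_nil.
  rewrite mulr0 add0r ZE mulr1 addr0 divff ?gt_eqF // expr1n; lra.
set m : R := n.+1%:R in IH ZE *.
have m0 : 0 < m by rewrite ltr0n.
have le1 : a * n.+2%:R / total_weight n.+1 <= 1.
  by rewrite ler_pdivrMr // mul1r ZE lerDl ltW.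
have le2 : 2 / total_weight n.+1 <= 2 / m.
  rewrite ler_pM2l // lef_pV2 ?posrE // ZE lerDr mulr_ge0 ?ler0n //; exact: ltW.
have le3 : (1 + 2 / total_weight n.+1) * wordEx n.+1 (fun w => \sum_(l <- lineages w) 2 ^+ size l)
   <= (1 + 2 / m) * (2 * m ^+ 2).
  apply: ler_pM => //.
  - by rewrite addr_ge0 // divr_ge0 // ltW.
  - rewrite -[leLHS](@wordE_cst _ _ choices choice_prob choice_prob_sum1 n.+1).
    apply: (@ler_wordE _ _ _ _ c0); first exact: choice_prob_ge0.
    by move=> w _; apply: sumr_ge0 => l _; apply: exprn_ge0.
  - by rewrite lerD2l.
apply: (le_trans (lerD le3 (ler_wpM2l _ le1))) => //.
have -> : (1 + 2 / m) * (2 * m ^+ 2) = 2 * m ^+ 2 + 4 * m.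
  by field; rewrite gt_eqF.
rewrite -[n.+2%:R]natr1 -/m; nra.
Qed.

End CopyLaw.

(** * Effect of one choice on the number of vertices *)

Section Certificates.
Local Open Scope nat_scope.
Implicit Types (w : seq copy_choice) (n k t : nat).

Definition wordY n k w := Y n k (tree_graph (targets w)).

Definition depth w := \max_(l <- lineages w) size l.

Lemma size_lineage w i : size (lineage w i) <= depth w.
Proof.
rewrite /lineage; have [lt|ge] := ltnP i (size (lineages w)).
  by rewrite /depth (leq_bigmax_seq (F := size) _ (mem_nth [::] lt)).
by rewrite nth_default.
Qed.

Lemma wordY_change n k w t c : size w = n -> t < n ->
  wordY n k w <= wordY n k (set_nth c0 w t c) + (2 * k + 3).
Proof.
move=> sw tn; rewrite /wordY.
apply: (Y_reroute (s := nth 0 (targets w) t)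
  (s' := nth 0 (targets (set_nth c0 w t c)) t)).
- by rewrite size_history.
- by rewrite size_history size_set_nth sw; apply/maxn_idPr.
by move=> i ilt; apply: targets_moved; rewrite sw.
Qed.

(** [A] gathers the lineages of the edges of a certificate. *)
Lemma second_degree_word_certificate w v k : exists A : seq nat,
  size A <= 2 * k * depth w /\
  (k <= second_degree (tree_graph (targets w)) v ->
   forall t c, t < size w -> t \notin A ->
     k <= second_degree (tree_graph (targets (set_nth c0 w t c))) v).
Proof.
have [/second_degree_certificate[E [sE Elt Ecert]]|kgt] :=
    leqP k (second_degree (tree_graph (targets w)) v); last by exists [::].
exists (flatten [seq lineage w i | i <- E]); split.
  rewrite size_flatten /shape -map_comp sumnE big_map.
  apply: (@leq_trans (\sum_(i <- E) depth w)).
    by apply: leq_sum => i _; apply: size_lineage.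
  by rewrite big_const_seq count_predT iter_addn_0 mulnC leq_mul2r sE orbT.
move=> _ t c tw tA; apply: Ecert.
  by rewrite !size_history size_set_nth; apply/maxn_idPr.
move=> i iE; have := Elt i iE; rewrite size_history => ilt.
apply: target_off_lineage => //; apply: contraNN tA => til.
by apply/flattenP; exists (lineage w i) => //; apply: map_f.
Qed.

Lemma wordY_certificates n k w : size w = n -> exists A : nat -> seq nat,
  (forall i, size (A i) <= 2 * k * depth w) /\
  forall t c, t < n -> wordY n k w <= wordY n k (set_nth c0 w t c)
    + count (fun i => (k <= second_degree (tree_graph (targets w)) i.+1)
                      && (t \in A i)) (iota 0 n).
Proof.
move=> sw; have [A AP] := choice (fun i => second_degree_word_certificate w i.+1 k).
exists A; split=> [i|t c tn]; first by have [] := AP i.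
rewrite /wordY !YE -count_predUI; apply: leq_trans (leq_addr _ _).
apply: sub_count => i /= ki; rewrite ki /=.
have [tA|tA] := boolP (t \in A i); first by rewrite orbT.
by rewrite orbF; have [_ /(_ ki)] := AP i; apply; rewrite ?sw.
Qed.

Lemma count_mem_iota (A : seq nat) n : count (mem A) (iota 0 n) <= size A.
Proof.
rewrite -size_filter; apply: uniq_leq_size; first by rewrite filter_uniq ?iota_uniq.
by move=> x; rewrite mem_filter => /andP[].
Qed.

End Certificates.

(** * The variance *)

Section Variance.
Variables (R : realType) (a : R).
Hypothesis a_gt0 : 0 < a.
Local Notation wordEx := (wordEx a).

(** If the depth exceeds [M] by [x], the longest lineage alone contributes at
    least 2^x to the last term, and x <= 2^x. *)
Lemma depth_le (M : nat) w : (depth w)%:R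
  <= M%:R + (\sum_(l <- lineages w) 2 ^+ size l) / 2 ^+ M :> R.
Proof.
set S := \sum_(l <- _) _.
have S0 : 0 <= S by apply: sumr_ge0 => l _; apply: exprn_ge0.
have [leM|ltM] := leqP (depth w) M.
  by rewrite ler_wpDr ?ler_nat // divr_ge0 // exprn_ge0.
rewrite -lerBlDl ler_pdivlMr ?exprn_gt0 // -natrB 1?ltnW //.
apply: (@le_trans _ _ (2 ^+ depth w)).
  rewrite -{2}(subnK (ltnW ltM)) exprD ler_pM2r ?exprn_gt0 //.
  by rewrite -natrX ler_nat ltnW // ltn_expl.
have : depth w \in [seq size l | l <- lineages w].
  rewrite /depth in ltM *; elim: (lineages w) ltM => [|l ls IH].
    by rewrite big_nil.
  rewrite big_cons /= inE maxnE; case: (leqP (\max_(j <- ls) size j) (size l)) => [le|lt].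
    by move: le; rewrite -subn_eq0 => /eqP->; rewrite addn0 eqxx.
  by rewrite (subnKC (ltnW lt)) => /IH ->; rewrite orbT.
move=> /mapP[l lin ->]; rewrite /S; have [i ilt <-] := nthP [::] lin.
rewrite (big_nth [::]) big_mkord (bigD1 (Ordinal ilt)) //= lerDl.
by apply: sumr_ge0 => j _; apply: exprn_ge0.
Qed.

(** One factor of each squared drop is bounded by 2 k + 3 <= 5 k, the other by
    the number of vertices whose certificate uses the choice [t]; the sum over
    [t] of the latter is the total size of the certificates. *)
Lemma resampling_energy n k w : size w = n -> (0 < k)%N ->
  \sum_(t < n) \sum_(c <- choices t) choice_prob a t c
     * sqpos ((wordY n k w)%:R - (wordY n k (set_nth c0 w t c))%:R)
  <= 10 * k%:R ^+ 2 * (depth w)%:R * (wordY n k w)%:R :> R.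
Proof.
move=> sw k0; have [A [sA drop]] := wordY_certificates k sw.
pose h i t := (k <= second_degree (tree_graph (targets w)) i.+1)%N && (t \in A i).
pose N t := count (fun i => h i t) (iota 0 n).
have bound (t : 'I_n) c :
    sqpos ((wordY n k w)%:R - (wordY n k (set_nth c0 w t c))%:R)
    <= 5 * k%:R * (N t)%:R :> R.
  rewrite /sqpos; set x : R := _ - _.
  have x1 : x <= 5 * k%:R.
    rewrite lerBlDr addrC -natrM -natrD ler_nat.
    apply: leq_trans (wordY_change k c sw (ltn_ord t)) _.
    by rewrite leq_add2l; lia.
  have x2 : x <= (N t)%:R.
    by rewrite lerBlDr addrC -natrD ler_nat; apply: drop.
  have m0 : 0 <= Num.max x 0 by rewrite le_max lexx orbT.
  rewrite expr2; apply: ler_pM => //; rewrite ge_max.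
    by rewrite x1 /= mulr_ge0.
  by rewrite x2 /= ler0n.
apply: (@le_trans _ _ (\sum_(t < n) 5 * k%:R * (N t)%:R)).
  apply: ler_sum => t _.
  apply: (@le_trans _ _ (\sum_(c <- choices t)
      choice_prob a t c * (5 * k%:R * (N t)%:R))).
    by apply: ler_sum => c _; apply: ler_wpM2l (bound t c); apply: choice_prob_ge0.
  by rewrite -mulr_suml choice_prob_sum1 // mul1r.
rewrite -mulr_sumr.
have : (\sum_(t < n) N t <= 2 * k * depth w * wordY n k w)%N.
  rewrite -(big_mkord xpredT N) /index_iota subn0.
  under eq_bigr => t _ do rewrite /N -sum1_count big_mkcond.
  rewrite exchange_big /= /wordY YE -sum1_count mulnC big_distrl /= big_mkcond [leqRHS]big_mkcond.
  apply: leq_sum => i _; rewrite -big_mkcond /= sum1_count /h mul1n.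
  case: ifP => ki; last by rewrite (eq_count (a2 := pred0)) ?count_pred0.
  exact: leq_trans (count_mem_iota _ _) (sA i).
rewrite -(ler_nat R) natr_sum => le1.
apply: (le_trans (ler_wpM2l _ le1)); first by rewrite mulr_ge0.
by rewrite !natrM le_eqVlt; apply/orP; left; apply/eqP; ring.
Qed.

Definition meanY n k : R := wordEx n (fun w => (wordY n k w)%:R).

Lemma variance_Y n k M : (0 < k)%N ->
  wordEx n (fun w => (wordY n k w)%:R ^+ 2) - meanY n k ^+ 2
  <= 10 * k%:R ^+ 2 * (M%:R * meanY n k + 2 * n%:R ^+ 3 / 2 ^+ M).
Proof.
move=> k0.
apply: (le_trans (Efron_Stein c0 (choice_prob_ge0 a_gt0) (choice_prob_sum1 a_gt0) n _)).
rewrite -wordE_sum.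
pose S w : R := \sum_(l <- lineages w) 2 ^+ size l.
apply: (@le_trans _ _ (wordEx n (fun w => 10 * k%:R ^+ 2 *
    (M%:R * (wordY n k w)%:R + n%:R / 2 ^+ M * S w)))).
  apply: (@ler_wordE _ _ _ _ c0); first exact: choice_prob_ge0.
  move=> w [sw _]; apply: (le_trans (resampling_energy sw k0)).
  rewrite -mulrA; apply: ler_wpM2l; first by rewrite mulr_ge0 ?exprn_ge0.
  apply: (le_trans (ler_wpM2r _ (depth_le M w))) => //.
  rewrite mulrDl lerD2l -/(S w) mulrAC [leRHS]mulrAC ler_wpM2r ?invr_ge0 ?exprn_ge0 //.
  rewrite mulrC ler_wpM2r ?ler_nat //.
    by apply: sumr_ge0 => l _; apply: exprn_ge0.
  by rewrite /wordY YE (leq_trans (count_size _ _)) // size_iota.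
rewrite /wordEx wordEZ wordED !wordEZ.
apply: ler_wpM2l; first by rewrite mulr_ge0 ?exprn_ge0.
rewrite lerD2l.
have -> : 2 * n%:R ^+ 3 / 2 ^+ M = n%:R / 2 ^+ M * (2 * n%:R ^+ 2) :> R by ring.
apply: ler_wpM2l; last exact: lineage_moment.
by rewrite divr_ge0 // exprn_ge0.
Qed.

End Variance.

(** * Vertices of large in-degree *)

Section Hubs.
Local Open Scope nat_scope.

Lemma count_eq_iota_le (P : pred nat) (x m n : nat) :
  count (fun s => (x == s) && P s) (iota m n) <= P x.
Proof.
have [Px|nPx] := boolP (P x).
  apply: leq_trans (count_eq_iota x m n).
  by apply: sub_count => s /andP[/eqP->].
rewrite (eq_count (a2 := pred0)) ?count_pred0 // => s /=.
by have [<-|//] := eqVneq x s; rewrite (negbTE nPx).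
Qed.

(** The at least [k] vertices other than [s] that are attached to a vertex [s]
    of in-degree greater than [k] all have second degree at least [k]. *)
Lemma Y_ge_hubs (tg : seq nat) k :
  k * count (fun s => k < count_mem s tg) (iota 1 (size tg))
  <= Y (size tg) k (tree_graph tg).
Proof.
set n := size tg; pose hub s := k < count_mem s tg.
pose g i s := (nth 0 tg i == s) && ((i.+1 != s) && hub s).
apply: (@leq_trans (count (fun i => (i.+1 != nth 0 tg i) && hub (nth 0 tg i)) (iota 0 n))).
  apply: (@leq_trans (\sum_(s <- iota 1 n) \sum_(i <- iota 0 n) g i s)).
    rewrite -sum1_count big_distrr /= big_mkcond; apply: leq_sum => s _.
    rewrite muln1; case: ifP => // ks.
    have -> : \sum_(i <- iota 0 n) g i s = count (g^~ s) (iota 0 n).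
      by rewrite -sum1_count [RHS]big_mkcond; apply: eq_bigr => i _; case: (g i s).
    rewrite -ltnS; apply: (leq_trans ks); rewrite count_nth.
    apply: leq_trans (count_neq_iota _ s.-1 _ _) _; rewrite ltnS.
    apply: sub_count => i /andP[/eqP iE iN]; rewrite /g iE eqxx /=; apply/andP; split.
      by apply: contraNneq iN => <-.
    by move: ks; rewrite /hub count_nth.
  rewrite exchange_big -sum1_count [leqRHS]big_mkcond; apply: leq_sum => i _ /=.
  have -> : \sum_(s <- iota 1 n) g i s = count (g i) (iota 1 n).
    by rewrite -sum1_count [RHS]big_mkcond; apply: eq_bigr => s _; case: (g i s).
  apply: leq_trans (count_eq_iota_le _ _ _ _) _.
  by case: (_ && _).
rewrite YE; apply: sub_count_in => i; rewrite mem_iota add0n /= => ilt /andP[iN hubi].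
by rewrite -ltnS; apply: leq_trans hubi _; apply: second_degree_ge_sibling.
Qed.

Definition num_indeg (n d : nat) (tg : seq nat) : nat :=
  count (fun v => count_mem v tg == d) (iota 1 n).

Lemma hubs_ge (tg : seq nat) n k :
  \sum_(d <- iota k.+1 k) num_indeg n d tg
  <= count (fun s => k < count_mem s tg) (iota 1 n).
Proof.
under eq_bigr => d _ do rewrite /num_indeg -sum1_count big_mkcond.
rewrite exchange_big -sum1_count [leqRHS]big_mkcond; apply: leq_sum => s _ /=.
rewrite -big_mkcond sum1_count.
apply: leq_trans (_ : count (fun d => (count_mem s tg == d) && (k < d)) (iota k.+1 k) <= _).
  by apply: sub_count_in => d; rewrite mem_iota => /andP[-> _] ->.
apply: leq_trans (count_eq_iota_le _ _ _ _) _.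
by case: ifP.
Qed.

End Hubs.

(** * The mean in-degree distribution *)

Section IndegreeLaw.
Variables (R : realType) (a : R).
Hypothesis a_gt0 : 0 < a.
Local Notation wordEx := (wordEx a).
Local Notation Z := (total_weight a).

Definition mean_indeg (n d : nat) : R :=
  wordEx n (fun w => (num_indeg n d (targets w))%:R).

Lemma num_indeg_rcons n d tg s : {subset tg <= iota 1 n} -> s \in iota 1 n.+1 ->
  (num_indeg n.+1 d (rcons tg s))%:R
  = (num_indeg n d tg)%:R
    + (if s == n.+1 then (d == 1)%:R
       else (count_mem s tg == d.-1)%:R * (0 < d)%N%:R - (count_mem s tg == d)%:R + (d == 0)%:R) :> R.
Proof.
move=> sub sin.
have notin : count_mem n.+1 tg = 0%N.
  by apply/count_memPn/negP => /sub; rewrite mem_iota add1n ltnn andbF.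
have rconsE v : count_mem v (rcons tg s) = (count_mem v tg + (s == v))%N.
  by rewrite -cats1 count_cat /= addn0.
have -> : num_indeg n.+1 d (rcons tg s)
    = (num_indeg n d (rcons tg s) + (count_mem n.+1 (rcons tg s) == d))%N.
  by rewrite /num_indeg -[in LHS](addn1 n) iotaD count_cat /= add1n addn0.
rewrite rconsE notin natrD /num_indeg.
under eq_count => v do rewrite rconsE.
have [->|sn] := eqVneq s n.+1.
  congr (_%:R + _%:R); last by case: d => [|[|d]].
  apply: eq_in_count => v; rewrite mem_iota add1n => /andP[_ vn].
  by rewrite (gtn_eqF vn) addn0.
have {sin sn} sin : s \in iota 1 n.
  move: sin; rewrite !mem_iota !add1n => /andP[-> /=].
  by rewrite !ltnS leq_eqVlt (negbTE sn).
rewrite addrA; congr (_ + _%:R); last by case: d.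
have cE (P : pred nat) : (count P (iota 1 n))%:R = \sum_(v <- iota 1 n) (P v)%:R :> R.
  by rewrite -sum1_count big_mkcond natr_sum; apply: eq_bigr => v _; case: (P v).
rewrite !cE !(bigD1_seq s sin (iota_uniq _ _)) /= eqxx addn1.
rewrite (eq_bigr (fun v => (count_mem v tg == d)%:R)) => [|v vs]; last first.
  by rewrite [s == v]eq_sym (negbTE vs) addn0.
case: d => [|d] /=; first by ring.
by rewrite eqSS; ring.
Qed.

(** A vertex of in-degree [e] receives the new edge with probability
    (e + a) / Z and then moves from the in-degree [e] to [e.+1]; a loop makes
    the new vertex start at in-degree 1. *)
Lemma num_indeg_step n d w : word_of choices c0 n w ->
  let tg := targets w in
  \sum_(c <- choices n) choice_prob a n c
     * (num_indeg n.+1 d (targets (rcons w c)))%:R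
  = (1 - (d%:R + a) / Z n) * (num_indeg n d tg)%:R
    + (if d is d'.+1 then (d'%:R + a) / Z n * (num_indeg n d' tg)%:R
                          + (d' == 0)%:R * (a / Z n)
       else 1 - a / Z n) :> R.
Proof.
move=> wP tg; have sub := targets_subset wP.
under eq_bigr => c _ do rewrite /targets history_rcons -/targets -/tg.
rewrite (attach_step a (fun s => (num_indeg n.+1 d (rcons tg s))%:R : R)) // -/tg.
rewrite num_indeg_rcons ?eqxx //; last by rewrite mem_iota add1n ltnS leqnn.
set N : R := (num_indeg n d tg)%:R.
pose hit e : R := \sum_(s <- iota 1 n) (count_mem s tg == e)%:R.
have hitE e : hit e = (num_indeg n e tg)%:R.
  by rewrite /hit /num_indeg -sum1_count [in RHS]big_mkcond /= natr_sum; apply: eq_bigr => s _; case: ifP.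
have hitw e : \sum_(s <- iota 1 n) ((count_mem s tg)%:R + a) * (count_mem s tg == e)%:R
    = (e%:R + a) * (num_indeg n e tg)%:R.
  rewrite -hitE mulr_sumr; apply: eq_bigr => s _.
  by case: eqP => [->//|_]; rewrite !mulr0.
have total : \sum_(s <- iota 1 n) ((count_mem s tg)%:R + a) = n%:R + n%:R * a.
  rewrite big_split /= big_const_seq count_predT size_iota iter_addr_0 mulr_natl.
  congr (_ + _).
  have := sum_count_mem (fun=> 1 : R) (iota_uniq 1 n) sub.
  rewrite big_const_seq count_predT size_history wP.1 iter_addr_0 => ->.
  by apply: eq_bigr => s _; rewrite mulr1.
have -> : \sum_(s <- iota 1 n) ((count_mem s tg)%:R + a) * (num_indeg n.+1 d (rcons tg s))%:R
  = (N + (d == 0)%:R) * (n%:R + n%:R * a) - (d%:R + a) * N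
    + (0 < d)%N%:R * ((d.-1%:R + a) * (num_indeg n d.-1 tg)%:R).
  rewrite -total -hitw -hitw !mulr_sumr -sumrB -big_split /=.
  rewrite big_seq [RHS]big_seq; apply: eq_bigr => s sin.
  rewrite num_indeg_rcons //; last first.
    by move: sin; rewrite !mem_iota !add1n !ltnS => /andP[-> /leqW].
  have -> : (s == n.+1) = false.
    by move: sin; rewrite mem_iota add1n ltnS => /andP[_ sn]; rewrite ltn_eqF.
  by rewrite -/N; ring.
have Z0 := total_weight_gt0 a_gt0 n.
have ZE := total_weightE a n.
have nE : n%:R + n%:R * a = Z n - a by rewrite ZE -natr1; ring.
rewrite nE; move: (Z n) (gt_eqF Z0) => z z0 {nE ZE Z0}.
case: d @N => [|d] N /=; first by rewrite -/N; field; rewrite z0.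
by rewrite eqSS; move: (d == 0)%:R => b; field; rewrite z0.
Qed.

Lemma mean_indeg0 n :
  mean_indeg n.+1 0 = (1 - a / Z n) * mean_indeg n 0 + (1 - a / Z n).
Proof.
rewrite /mean_indeg [LHS]wordES.
rewrite -[X in _ + X](wordE_cst (choice_prob_sum1 a_gt0) n) -wordEZ -wordED.
apply: (@eq_wordE _ _ _ _ c0); first exact: choice_prob_ge0.
by move=> w wP; rewrite (num_indeg_step _ wP) add0r.
Qed.

Lemma mean_indegS n d :
  mean_indeg n.+1 d.+1 = (1 - (d.+1%:R + a) / Z n) * mean_indeg n d.+1
    + ((d%:R + a) / Z n * mean_indeg n d + (d == 0)%:R * (a / Z n)).
Proof.
rewrite /mean_indeg [LHS]wordES.
rewrite -[X in _ + (_ + X)](wordE_cst (choice_prob_sum1 a_gt0) n) -!wordEZ -!wordED.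
apply: (@eq_wordE _ _ _ _ c0); first exact: choice_prob_ge0.
by move=> w wP; rewrite (num_indeg_step _ wP).
Qed.

Lemma mean_indeg_ge0 n d : 0 <= mean_indeg n d.
Proof.
rewrite -(wordE_cst (choice_prob_sum1 a_gt0) n 0).
by apply: (@ler_wordE _ _ _ _ c0) => [|w _]; [exact: choice_prob_ge0|exact: ler0n].
Qed.

(** The limiting proportion of vertices of in-degree [d]: up to the
    loops, c_d n solves the recurrence of the means. *)
Fixpoint indeg_density (d : nat) : R :=
  if d is d'.+1 then indeg_density d' * (d'%:R + a) / (d'%:R + 2 * a + 2)
  else (a + 1) / (2 * a + 1).

Lemma indeg_density_gt0 d : 0 < indeg_density d.
Proof.
have a0 : 0 < a := a_gt0.
elim: d => [|d IH] /=; first by rewrite divr_gt0 //; lra.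
have d0 : 0 <= d%:R :> R by [].
by rewrite divr_gt0 ?mulr_gt0 //; lra.
Qed.

Lemma indeg_densityS d :
  indeg_density d.+1 * (d%:R + 2 * a + 2) = indeg_density d * (d%:R + a).
Proof. have a0 : 0 < a := a_gt0. by have d0 : 0 <= d%:R :> R by []; rewrite /= divfK // gt_eqF //; lra. Qed.

(** By [indeg_densityS] the left-hand side is nonincreasing in [d], and equality
    holds at 0. *)
Lemma indeg_density_le d : indeg_density d * (d%:R + 2 * a + 1) <= a + 1.
Proof.
have a0 : 0 < a := a_gt0.
elim: d => [|d IH]; first by rewrite /= add0r divfK // gt_eqF //; lra.
apply: le_trans IH; have d0 : 0 <= d%:R :> R by [].
have -> : d.+1%:R + 2 * a + 1 = d%:R + 2 * a + 2 :> R by rewrite -natr1; ring.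
by rewrite indeg_densityS ler_pM2l ?indeg_density_gt0 //; lra.
Qed.

(** As Z n = (a + 1) (n + a / (a + 1)), the shift a / (a + 1) makes the left-hand
    side without -1 an exact solution of the recurrence without the terms due
    to loops.  The error -1 persists through the recurrence, and absorbs the
    loops, as long as the coefficient 1 - (d + a) / Z n is nonnegative; when it
    is negative, [d] is so large that the bound to be proved is nonpositive. *)
Lemma mean_indeg_lower n d :
  indeg_density d * (n%:R + a / (a + 1)) - 1 <= mean_indeg n d.
Proof.
have a0 : 0 < a := a_gt0.
have a1 : 0 < a + 1 by lra.
elim: n d => [|n IH] d.
  apply: le_trans (mean_indeg_ge0 _ _); rewrite add0r subr_le0 mulrA ler_pdivrMr // mul1r.
  apply: le_trans (indeg_density_le d); rewrite ler_pM2l ?indeg_density_gt0 //.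
  by have d0 : 0 <= d%:R :> R by []; lra.
set m : R := n%:R + a / (a + 1) in IH *.
have -> : n.+1%:R + a / (a + 1) = m + 1 by rewrite /m -natr1; ring.
have ZE : Z n = (a + 1) * m by rewrite total_weightE /m -natr1; field; rewrite gt_eqF.
have Z0 := total_weight_gt0 a_gt0 n.
have m0 : 0 < m by move: Z0; rewrite ZE pmulr_rgt0.
case: d => [|d].
  rewrite mean_indeg0.
  have le1 : 0 <= 1 - a / Z n.
    rewrite subr_ge0 ler_pdivrMr // mul1r total_weightE -natr1.
    by have n0 : 0 <= n%:R :> R by []; nra.
  have -> : indeg_density 0 * (m + 1) - 1
    = (1 - a / Z n) * (indeg_density 0 * m - 1) + (1 - a / Z n).
    by rewrite /= ZE; field; rewrite !gt_eqF //; lra.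
  by rewrite lerD2r ler_wpM2l.
set q : R := d%:R + a; have q0 : 0 < q by rewrite ltr_wpDl.
have qE : d.+1%:R + a = q + 1 by rewrite /q -natr1; ring.
have cE : indeg_density d.+1 * (q + a + 2) = indeg_density d * q.
  by rewrite -indeg_densityS /q; congr (_ * _); ring.
have [p1|p1] := leP ((q + 1) / Z n) 1; last first.
  apply: le_trans (mean_indeg_ge0 _ _); rewrite subr_le0.
  rewrite ltr_pdivlMr // mul1r ZE in p1.
  have := indeg_density_le d.+1; rewrite -natr1.
  have c1 := indeg_density_gt0 d.+1.
  have -> : d%:R + 1 + 2 * a + 1 = q + a + 2 by rewrite /q; ring.
  move=> le1; rewrite -(ler_pM2l a1) mulr1; apply: le_trans le1.
  by rewrite mulrCA ler_pM2l // mulrDr; lra.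
rewrite mean_indegS qE -/q.
have le0 : 0 <= 1 - (q + 1) / Z n by rewrite subr_ge0.
have leq0 : 0 <= q / Z n by rewrite divr_ge0 // ltW.
have e1 := ler_wpM2l le0 (IH d.+1); have e2 := ler_wpM2l leq0 (IH d).
have e3 : 0 <= (d == 0)%:R * (a / Z n) by rewrite mulr_ge0 ?divr_ge0 // ltW.
apply: le_trans (lerD e1 (ler_wpDr e3 e2)).
have -> : q / Z n * (indeg_density d * m - 1)
    = indeg_density d.+1 * (q + a + 2) * (m / Z n) - q / Z n by rewrite cE; ring.
have Zi : 0 < (Z n)^-1 by rewrite invr_gt0.
rewrite -subr_ge0.
have -> : (1 - (q + 1) / Z n) * (indeg_density d.+1 * m - 1)
   + (indeg_density d.+1 * (q + a + 2) * (m / Z n) - q / Z n)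
   - (indeg_density d.+1 * (m + 1) - 1) = (Z n)^-1.
  by rewrite ZE; field; rewrite !gt_eqF.
exact: ltW.
Qed.

(** Young's inequality for [1 + y] and 1, with exponents [r] and its conjugate. *)
Lemma Bernoulli_powR (r y : R) : 1 < r -> 0 <= y -> 1 + r * y <= (1 + y) `^ r.
Proof.
move=> r1 y0.
have := @conjugate_powR R (1 + y) 1 r (r / (r - 1)).
rewrite powR1 mulr1 => /(_ _ _ _ _ _) H.
have {H} : 1 + y <= (1 + y) `^ r / r + 1 / (r / (r - 1)).
  apply: H => //; [lra|lra| by rewrite divr_gt0 //; lra|].
  by field; rewrite !gt_eqF //; lra.
set P := (1 + y) `^ r; have r0 : 0 < r by lra.
rewrite -(ler_pM2l r0).
have -> : r * (P / r + 1 / (r / (r - 1))) = P + r - 1.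
  by field; rewrite !gt_eqF //; lra.
lra.
Qed.

(** With x = d + a, consecutive densities have the ratio x / (x + 2 + a), which
    by Bernoulli's inequality is at least (x / (x + 1))^(2 + a); these powers
    telescope. *)
Lemma indeg_density_ge d :
  indeg_density 0 * (a / (d%:R + a)) `^ (2 + a) <= indeg_density d.
Proof.
have a0 : 0 < a := a_gt0.
elim: d => [|d IH].
  by rewrite add0r divff ?gt_eqF // powR1 mulr1.
have d0 : 0 <= d%:R :> R by [].
set x : R := d%:R + a; have x0 : 0 < x by rewrite ltr_wpDl.
have -> : d.+1%:R + a = x + 1 by rewrite /x -natr1; ring.
have -> : a / (x + 1) = a / x * (x / (x + 1)) by field; rewrite !gt_eqF //; lra.
have -> : indeg_density d.+1 = indeg_density d * (x / (x + (2 + a))).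
  by rewrite /= mulrA /x; congr (_ / _); ring.
rewrite powRM ?divr_ge0 ?addr_ge0 ?(ltW x0) ?(ltW a_gt0) // mulrA.
apply: ler_pM => //; first by rewrite mulr_ge0 ?powR_ge0 // ltW // indeg_density_gt0.
  exact: powR_ge0.
have xi : 0 < x^-1 by rewrite invr_gt0.
have -> : x / (x + 1) = (1 + x^-1)^-1 by field; rewrite !gt_eqF //; lra.
have -> : x / (x + (2 + a)) = (1 + (2 + a) * x^-1)^-1 by field; rewrite !gt_eqF //; lra.
rewrite -[(1 + x^-1)^-1]powR_inv1 ?addr_ge0 ?(ltW xi) // powRAC powR_inv1 ?powR_ge0 //.
have pos1 : 0 < 1 + x^-1 by lra.
have pos2 : 0 < 1 + (2 + a) / x by nra.
rewrite lef_pV2 ?posrE ?powR_gt0 //.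
by apply: Bernoulli_powR; [lra|exact: ltW].
Qed.

Definition density_const : R := indeg_density 0 * (a / (2 + a)) `^ (2 + a).

Lemma density_const_gt0 : 0 < density_const.
Proof. by rewrite mulr_gt0 ?indeg_density_gt0 ?powR_gt0 // divr_gt0 // addr_gt0. Qed.

Lemma indeg_density_ge_pow d k : (0 < k)%N -> (d <= 2 * k)%N ->
  density_const * k%:R `^ (- (2 + a)) <= indeg_density d.
Proof.
have a0 : 0 < a := a_gt0.
move=> k0 dk; apply: le_trans (indeg_density_ge d).
rewrite /density_const -mulrA ler_pM2l ?indeg_density_gt0 //.
have k1 : 1 <= k%:R :> R by rewrite ler1n.
have d1 : d%:R <= 2 * k%:R :> R by rewrite -natrM ler_nat.
have d0 : 0 <= d%:R :> R by [].
have kn0 : k%:R != 0 :> R by rewrite gt_eqF //; lra.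
have -> : k%:R `^ (- (2 + a)) = (k%:R^-1) `^ (2 + a) :> R.
  by rewrite -powR_inv1 // -powRrM mulN1r.
rewrite -powRM ?divr_ge0 ?invr_ge0 //; try lra.
apply: ge0_ler_powR; rewrite ?nnegrE ?mulr_ge0 ?divr_ge0 ?invr_ge0 //; try lra.
rewrite -mulrA ler_pM2l // -invfM lef_pV2 ?posrE; [nra| | lra].
by rewrite mulr_gt0; lra.
Qed.

(** The in-degrees d with k < d <= 2 k have a density of order k^(-2-a) each,
    and every vertex counted contributes [k]. *)
Lemma meanY_lower n k : (0 < k)%N ->
  k%:R ^+ 2 * (density_const * k%:R `^ (- (2 + a)) * n%:R - 1) <= meanY a n k.
Proof.
have a0 : 0 < a := a_gt0.
move=> k0; pose c : R := density_const * k%:R `^ (- (2 + a)).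
have c_ge0 : 0 <= c by rewrite mulr_ge0 ?powR_ge0 // ltW // density_const_gt0.
apply: (@le_trans _ _ (k%:R * \sum_(d <- iota k.+1 k) mean_indeg n d)).
  rewrite expr2 -mulrA ler_wpM2l //.
  apply: (@le_trans _ _ (\sum_(d <- iota k.+1 k) (c * n%:R - 1))).
    by rewrite big_const_seq count_predT size_iota iter_addr_0 mulr_natl.
  rewrite big_seq [leRHS]big_seq; apply: ler_sum => d; rewrite mem_iota => /andP[_ dk].
  apply: le_trans (mean_indeg_lower n d); rewrite lerD2r.
  apply: ler_pM => //; last by rewrite lerDl divr_ge0 //; lra.
  by apply: indeg_density_ge_pow => //; move: dk; lia.
rewrite /mean_indeg -wordE_sum -wordEZ.
apply: (@ler_wordE _ _ _ _ c0) => [|w [sw _]]; first exact: choice_prob_ge0.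
have st : size (targets w) = n by rewrite size_history.
rewrite -natr_sum -natrM ler_nat /wordY -st.
by apply: leq_trans (Y_ge_hubs _ _); rewrite leq_mul2l hubs_ge orbT.
Qed.
End IndegreeLaw.

(** * Chebyshev's inequality *)

Section Chebyshev.
Variables (R : realType) (a : R).
Hypothesis a_gt0 : 0 < a.

Lemma meanYE n k : Ex a n (fun G => (Y n k G)%:R) = meanY a n k.
Proof. by rewrite Ex_law. Qed.

Lemma Pr_Ex n (A : pred multigraph) : Pr a n A = Ex a n (fun G => (A G)%:R).
Proof.
rewrite /Pr /Ex big_mkcond; apply: eq_bigr => Gw _.
by case: (A _); rewrite ?mulr1 ?mulr0.
Qed.

Lemma Pr_ge0 n (A : pred multigraph) : 0 <= Pr a n A.
Proof.
rewrite Pr_Ex Ex_law // -(wordE_cst (choice_prob_sum1 a_gt0) n 0).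
by apply: (@ler_wordE _ _ _ _ dflt_choice) => [|w _]; [exact: choice_prob_ge0|exact: ler0n].
Qed.

Lemma Chebyshev_Y n k (b : R) : 0 < b ->
  Pr a n (fun G => `|(Y n k G)%:R - meanY a n k| > b)
  <= (wordEx a n (fun w => (wordY n k w)%:R ^+ 2) - meanY a n k ^+ 2) / b ^+ 2.
Proof.
move=> b0; rewrite Pr_Ex Ex_law //; set m := meanY a n k.
apply: (@le_trans _ _ (wordEx a n (fun w =>
   (b ^+ 2)^-1 * ((wordY n k w)%:R ^+ 2 - (2 * m * (wordY n k w)%:R - m ^+ 2))))).
  apply: (@ler_wordE _ _ _ _ dflt_choice) => [|w _]; first exact: choice_prob_ge0.
  rewrite -/(wordY n k w); set y : R := (wordY n k w)%:R.
  have -> : y ^+ 2 - (2 * m * y - m ^+ 2) = `|y - m| ^+ 2 by rewrite real_normK ?num_real //; ring.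
  case: ltP => [lt|_]; last by rewrite mulr_ge0 ?invr_ge0 ?exprn_ge0 // ltW.
  rewrite mulrC ler_pdivlMr ?exprn_gt0 // mul1r.
  by rewrite lerXn2r ?nnegrE ?ltW // (lt_trans b0).
rewrite /wordEx wordEZ wordEB wordEB wordEZ wordE_cst; last exact: choice_prob_sum1.
rewrite -[wordE _ _ n (fun w => (wordY n k w)%:R)]/m.
by rewrite le_eqVlt; apply/orP; left; apply/eqP; ring.
Qed.

End Chebyshev.

(** * Powers and logarithms *)

Section PowerBounds.
Variable R : realType.
Implicit Types x y p : R.

Lemma ler_powRN x y p : 0 < x -> x <= y -> 0 <= p -> y `^ (- p) <= x `^ (- p).
Proof.
move=> x0 xy p0; have y0 := lt_le_trans x0 xy.
rewrite !powRN lef_pV2 ?posrE ?powR_gt0 //.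
by apply: ge0_ler_powR; rewrite ?nnegrE ?(ltW x0) ?(ltW y0).
Qed.

Lemma near_powR_ge p (A : R) : 0 < p -> \forall n \near \oo, A <= n%:R `^ p.
Proof.
move=> p0; pose B := Num.max A 1; have B0 : 0 < B by rewrite lt_max ltr01 orbT.
near=> n; apply: (@le_trans _ _ B); first by rewrite le_max lexx.
have -> : B = (B `^ p^-1) `^ p by rewrite -powRrM mulVf ?gt_eqF // powRr1 // ltW.
apply: ge0_ler_powR; rewrite ?nnegrE ?powR_ge0 ?(ltW p0) //.
by near: n; apply: nbhs_infty_ger.
Unshelve. all: by end_near. Qed.

Lemma cvg_powRN p (K : R) : 0 < p -> (fun n : nat => K * n%:R `^ (- p)) @ \oo --> (0 : R).
Proof.
move=> p0; apply/cvgr0Pnorm_le => e e0; near=> n.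
have n0 : (0 < n)%N by near: n; exists 1%N.
rewrite normrM [`|_ `^ _|]ger0_norm ?powR_ge0 // powRN.
rewrite ler_pdivrMr ?powR_gt0 ?ltr0n // mulrC -ler_pdivrMr //.
by near: n; apply: near_powR_ge.
Unshelve. all: by end_near. Qed.

(** [M] is of the order of 3 log_2 n, hence below any power of [n]. *)
Lemma log_scale (n : nat) (eta : R) : (0 < n)%N -> 0 < eta -> exists M : nat,
  2 * n%:R ^+ 3 <= 2 ^+ M :> R /\ 1 <= M%:R :> R /\ M%:R <= (3 / (eta * ln 2) + 4) * n%:R `^ eta.
Proof.
move=> n0 eta0; pose t := trunc_log 2 n; exists (3 * t + 4)%N.
have /andP[tn nt] := trunc_log_bounds (isT : 1 < 2)%N n0.
have ln2 : 0 < ln 2 :> R by rewrite ln_gt0 // ltr1n.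
have x0 : 0 < n%:R :> R by rewrite ltr0n.
split; last split.
- have -> : (3 * t + 4 = (t.+1 * 3).+1)%N by lia.
  rewrite [2 ^+ _]exprS ler_pM2l // exprM lerXn2r ?nnegrE ?exprn_ge0 //.
  by rewrite -natrX ler_nat ltnW.
- by rewrite ler1n addn_gt0 orbT.
have p1 : 1 <= n%:R `^ eta.
  rewrite -[leLHS](powRr0 n%:R); apply: ler_powR; last exact: ltW.
  by rewrite ler1n.
have tle : t%:R * (eta * ln 2) <= n%:R `^ eta.
  apply: le_trans (ltW (ln_sublinear (powR_gt0 eta x0))).
  rewrite ln_powR mulrCA ler_pM2l // mulr_natl -lnXn //.
  by rewrite ler_ln ?posrE ?exprn_gt0 // -natrX ler_nat.
rewrite natrD natrM [leRHS]mulrDl; apply: lerD; last by rewrite ler_peMr.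
by rewrite mulrAC -mulrA ler_pM2l // ler_pdivlMr // mulr_gt0.
Qed.

End PowerBounds.

(** * Concentration *)

Section Concentration.
Variables (R : realType) (a delta : R).
Hypotheses (a_gt0 : 0 < a) (delta_gt0 : 0 < delta).
Let beta : R := 1 / (2 + a + delta).

Let beta_gt0 : 0 < beta.
Proof. by rewrite divr_gt0 // !addr_gt0. Qed.

Let betaE : 2 * beta + a * beta + delta * beta = 1.
Proof.
have den : 0 < 2 + a + delta by rewrite !addr_gt0.
by rewrite /beta; field; rewrite gt_eqF.
Qed.

(** The second bound required makes the main term of [meanY_lower] at least
    twice its error term. *)
Lemma meanY_poly_lower n k (C : R) : (0 < n)%N -> (0 < k)%N -> 0 < C ->
  k%:R <= C * n%:R `^ beta ->
  2 <= density_const a * C `^ (- (2 + a)) * n%:R `^ (delta * beta) ->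
  density_const a / 2 * C `^ (- a) * n%:R `^ ((2 + delta) * beta) <= meanY a n k.
Proof.
have a0 : 0 < a := a_gt0; have D0 := density_const_gt0 a_gt0.
have bE := betaE; have b0 := beta_gt0.
move=> n0 k0 C0 kC big; set x : R := n%:R in kC big *.
have x0 : 0 < x by rewrite ltr0n.
have k1 : 0 < k%:R :> R by rewrite ltr0n.
have scale p : 0 <= p -> C `^ (- p) * x `^ (1 - p * beta) <= k%:R `^ (- p) * x.
  move=> p0; have -> : C `^ (- p) * x `^ (1 - p * beta) = (C * x `^ beta) `^ (- p) * x.
    rewrite powRM ?powR_ge0 ?(ltW C0) // -powRrM -mulrA -[X in _ = _ * (_ * X)](powRr1 (ltW x0)).
    rewrite -powRD; last by rewrite (gt_eqF x0) implybT.
    by congr (_ * _ `^ _); ring.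
  by rewrite ler_pM2r // ler_powRN.
apply: le_trans (meanY_lower a_gt0 n k0); rewrite -/x.
set T := density_const a * _ * x.
have T2 : 2 <= T.
  apply: (le_trans big); rewrite /T -[leLHS]mulrA -[leRHS]mulrA ler_pM2l //.
  have -> : delta * beta = 1 - (2 + a) * beta by lra.
  by apply: scale; lra.
apply: (@le_trans _ _ (k%:R ^+ 2 * (T / 2))); last first.
  by rewrite ler_pM2l ?exprn_gt0 //; lra.
have -> : k%:R ^+ 2 * (T / 2) = density_const a / 2 * (k%:R `^ (- a) * x).
  have -> : k%:R `^ (- a) = k%:R ^+ 2 * k%:R `^ (- (2 + a)).
    rewrite -powR_mulrn // -powRD; last by rewrite (gt_eqF k1) implybT.
    by congr (_ `^ _); ring.
  by rewrite /T; field.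
rewrite -[leLHS]mulrA ler_pM2l ?divr_gt0 //.
have -> : (2 + delta) * beta = 1 - a * beta by lra.
exact/scale/ltW.
Qed.

(** The variance is at most 20 k^2 M N with N the mean, so the probability is at
    most 20 k^2 M N^(-(1 - 2 eps)).  Here k^2 is at most of order n^(2 beta), M at
    most of order n^eta, and N at least of order n^((2 + delta) beta); the choices of [eps] and
    [eta] each cost a factor n^(delta beta / 4) of the gain n^(-delta beta). *)
Lemma deviation_bound n k (C : R) : 0 < C -> (0 < n)%N -> (0 < k)%N ->
  let EY := meanY a n k in
  let eps := delta / (8 * (2 + delta)) in
  let eta := delta * beta / 4 in
  let c := density_const a / 2 * C `^ (- a) in
  k%:R <= C * n%:R `^ beta ->
  2 <= density_const a * C `^ (- (2 + a)) * n%:R `^ (delta * beta) ->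
  1 <= c * n%:R `^ ((2 + delta) * beta) ->
  Pr a n (fun G => `|(Y n k G)%:R - EY| > EY `^ (1 - eps))
  <= 20 * C ^+ 2 * (3 / (eta * ln 2) + 4) * c `^ (- (1 - 2 * eps))
     * n%:R `^ (- (delta * beta / 2)).
Proof.
have a0 : 0 < a := a_gt0; have d0 : 0 < delta := delta_gt0.
have b0 := beta_gt0; have D0 := density_const_gt0 a_gt0.
move=> C0 n0 k0 EY eps eta c kC big1 big2.
have c0 : 0 < c by rewrite /c mulr_gt0 ?divr_gt0 ?powR_gt0.
have lower := meanY_poly_lower n0 k0 C0 kC big1; rewrite -/c -/EY in lower.
set x : R := n%:R in kC big1 big2 lower *.
have x0 : 0 < x by rewrite ltr0n.
have xb0 : 0 < x `^ beta := powR_gt0 _ x0.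
have EY1 : 1 <= EY := le_trans big2 lower.
have EY0 : 0 < EY by lra.
have eta0 : 0 < eta by apply: divr_gt0; [exact: mulr_gt0|exact: ltr0n].
have eps0 : 0 < eps by rewrite /eps divr_gt0 ?mulr_gt0 ?addr_gt0.
have eps1 : eps <= 1 / 8.
  by rewrite /eps ler_pdivrMr ?mulr_gt0 ?addr_gt0 //; lra.
have [M [MM [M1 Mx]]] := log_scale n0 eta0; rewrite -/x in MM Mx.
set L := 3 / (eta * ln 2) + 4 in Mx *.
apply: (le_trans (Chebyshev_Y a_gt0 n k (powR_gt0 _ EY0))); rewrite -/EY.
have var := variance_Y a_gt0 n M k0; rewrite -/EY -/x in var.
have tail : 2 * x ^+ 3 / 2 ^+ M <= 1 by rewrite ler_pdivrMr ?exprn_gt0 // mul1r.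
have var2 : wordEx a n (fun w => (wordY n k w)%:R ^+ 2) - EY ^+ 2
    <= 20 * k%:R ^+ 2 * M%:R * EY.
  apply: (le_trans var).
  have -> : 20 * k%:R ^+ 2 * M%:R * EY = 10 * k%:R ^+ 2 * (2 * (M%:R * EY)) by ring.
  apply: ler_wpM2l; first by rewrite mulr_ge0 ?exprn_ge0.
  have : 1 * 1 <= M%:R * EY by apply: ler_pM.
  lra.
have EYsq : (EY `^ (1 - eps)) ^+ 2 = EY * EY `^ (1 - 2 * eps).
  rewrite -{2}(powRr1 (ltW EY0)) -powRD; last by rewrite (gt_eqF EY0) implybT.
  rewrite -powR_mulrn ?powR_ge0 // -powRrM; congr (_ `^ _); ring.
apply: (@le_trans _ _ (20 * k%:R ^+ 2 * M%:R * EY `^ (- (1 - 2 * eps)))).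
  rewrite ler_pdivrMr ?exprn_gt0 ?powR_gt0 // EYsq powRN.
  apply: (le_trans var2); rewrite le_eqVlt; apply/orP; left; apply/eqP.
  by field; rewrite gt_eqF // powR_gt0.
have exps : (x `^ beta) ^+ 2 * x `^ eta * (x `^ ((2 + delta) * beta)) `^ (- (1 - 2 * eps))
    = x `^ (- (delta * beta / 2)).
  rewrite -powR_mulrn ?powR_ge0 // -!powRrM -!powRD ?(gt_eqF x0) ?implybT //.
  congr (_ `^ _); rewrite /eta /eps; field.
  by rewrite gt_eqF // addr_gt0.
have -> : 20 * C ^+ 2 * L * c `^ (- (1 - 2 * eps)) * x `^ (- (delta * beta / 2))
  = 20 * (C * x `^ beta) ^+ 2 * (L * x `^ eta)
    * (c * x `^ ((2 + delta) * beta)) `^ (- (1 - 2 * eps)).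
  by rewrite -exps [(c * _) `^ _]powRM ?powR_ge0 ?(ltW c0) //; ring.
apply: ler_pM; rewrite ?mulr_ge0 ?exprn_ge0 ?powR_ge0 //.
  apply: ler_pM; rewrite ?mulr_ge0 ?exprn_ge0 //.
  by rewrite ler_pM2l // lerXn2r ?nnegrE // mulr_ge0 ?powR_ge0 // ltW.
apply: ler_powRN => //; first by rewrite mulr_gt0 // powR_gt0.
by lra.
Qed.

End Concentration.

Theorem theorem5 (R : realType) (a delta : R) (k : nat -> nat) :
  0 < a -> 0 < delta -> (forall n, (0 < k n)%N) ->
  (fun n => (k n)%:R : R) =O_\oo (fun n => n%:R `^ (1 / (2 + a + delta)) : R) ->
  exists2 eps : R, 0 < eps &
    (fun n : nat =>
       let EY := Ex a n (fun G => (Y n (k n) G)%:R) in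
       Pr a n (fun G => `|(Y n (k n) G)%:R - EY| > EY `^ (1 - eps)))
    @ \oo --> (0 : R).
Proof.
move=> a0 d0 k0 /eqO_exP[C C_gt0 kC].
exists (delta / (8 * (2 + delta))).
  by rewrite divr_gt0 ?mulr_gt0 ?addr_gt0.
set beta : R := 1 / (2 + a + delta) in kC.
have beta0 : 0 < beta by rewrite divr_gt0 ?addr_gt0.
pose c := density_const a / 2 * C `^ (- a).
have D0 := density_const_gt0 a0.
have c0 : 0 < c by rewrite /c mulr_gt0 ?divr_gt0 ?powR_gt0.
pose K := 20 * C ^+ 2 * (3 / (delta * beta / 4 * ln 2) + 4)
  * c `^ (- (1 - 2 * (delta / (8 * (2 + delta))))).
have p0 : 0 < delta * beta / 2 by apply: divr_gt0; [exact: mulr_gt0|exact: ltr0n].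
apply: (@squeeze_cvgr _ _ _ _ (cst 0) (fun n : nat => K * n%:R `^ (- (delta * beta / 2)))).
- near=> n; rewrite Pr_ge0 //=; rewrite meanYE //.
  have n0 : (0 < n)%N by near: n; exists 1%N.
  apply: deviation_bound => //.
  + have kn : `|(k n)%:R| <= C * `|n%:R `^ beta| :> R by near: n.
    by move: kn; rewrite !ger0_norm ?powR_ge0.
  + rewrite mulrC -ler_pdivrMr; last by rewrite mulr_gt0 ?powR_gt0.
    by near: n; apply: near_powR_ge; rewrite mulr_gt0.
  + rewrite mulrC -ler_pdivrMr //.
    by near: n; apply: near_powR_ge; rewrite mulr_gt0 ?addr_gt0.
- exact: cvg_cst.
- exact: cvg_powRN.
Unshelve. all: by end_near. Qed.
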